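(* Let $\mathcal{A}$ be an affine plane of order $q$, with $q\geq 25$, and let $B$ be a blocking set of $\mathcal{A}$. Then $B$ contains at least $q+\lfloor\sqrt{q}\rfloor+3$ points.
   Context: Affine planes are arbitrary (axiomatic) finite affine planes, not necessarily desarguesian; an affine plane of order $q$ has exactly $q$ points on every line, and $q$ is an integer that is not assumed to be a prime power. A blocking set in an affine plane $\mathcal{A}$ is a set $B$ of points of $\mathcal{A}$ such that every line of $\mathcal{A}$ contains at least one point of $B$. *)

(* Defs.v *)
From Stdlib Require PeanoNat.
From mathcomp Require Import all_boot.

Set Implicit Arguments.
Unset Strict Implicit.
Unset Printing Implicit Defensive.

(* Lines are identified with their point sets; this loses no generality, since
   the axioms force every line to carry two points, which determine it. *)
Record affine_plane := AffinePlane {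
  point : finType;
  lines : {set {set point}};
  line_through : forall x y : point, x != y ->
    exists! l : {set point}, [/\ l \in lines, x \in l & y \in l];
  parallel_through : forall (x : point) (l : {set point}),
    l \in lines -> x \notin l ->
    exists! m : {set point}, [/\ m \in lines, x \in m & [disjoint m & l]];
  (* Distinctness is needed to exclude the one-point structure without lines. *)
  noncollinear : exists x y z : point,
    [/\ x != y, y != z, x != z &
      forall l : {set point}, l \in lines -> ~ [/\ x \in l, y \in l & z \in l]]
}.

Definition has_order (A : affine_plane) (q : nat) : Prop :=
  forall l : {set point A}, l \in lines A -> #|l| = q.

Definition blocking_set (A : affine_plane) (B : {set point A}) : Prop :=
  forall l : {set point A}, l \in lines A -> exists2 x, x \in l & x \in B.

(* Main.v *)
Require Import Defs.
From Stdlib Require PeanoNat.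
From Stdlib Require Import ZArith.
From mathcomp Require Import all_boot zify.

Set Implicit Arguments.
Unset Strict Implicit.
Unset Printing Implicit Defensive.

(** Let n be the integer part of the square root of q, so that n >= 5, and
    suppose that some blocking set has at most q + n + 2 points; after adding
    points it has exactly q + n + 2. Call the excess e(l) of a line l the number
    of points of B on l beyond the first.

    Each of the q + 1 parallel classes consists of q lines covering every point
    once, so its excesses sum to n + 2. Through a point outside B pass q + 1
    lines, whose excesses sum to n + 1; as no line lies inside B, every excess is
    at most n + 1. On the other hand, counting ordered pairs of points of B by
    the line joining them fixes the sum of all e(l)^2, and its average over the
    parallel classes exceeds q + n (excess_squares_bound). A class with total
    excess n + 2 can reach this only if nearly all the excess sits on one line:
    the sum of squares is (n + 1)^2 + 1 at most if the class has a line of excess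
    n + 1, n^2 + 2^2 if its largest excess is n, and (n - 1)^2 + 3^2 otherwise
    (sum_squares_bound). Thus there are many long lines, those of excess n + 1
    or n; let a and b be their numbers (sum_excess_squares_le).

    But the long lines are too crowded on the q + n + 2 points of B: they carry
    t = a(n + 2) + b(n + 1) incidences with B, while two of them share at most
    one point, and Cauchy-Schwarz bounds t^2 accordingly (linear_family_bound,
    long_lines_second_moment). The lower and the upper estimate contradict each
    other as soon as n >= 5 (counting_contradiction); for n = 5 the margin is
    slim, which is why lines of excess n are counted as well. *)

(** * Sums of natural numbers and families of sets *)

Lemma sum_indicator (T : finType) (D : {set T}) (P : pred T) :
  \sum_(x in D) (P x : nat) = #|[set x in D | P x]|.
Proof.
rewrite -sum1dep_card [RHS]big_mkcondr /=.
by apply: eq_bigr => x _; case: (P x).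
Qed.

Lemma card_unique (T : finType) (D : {set T}) :
  (exists! x, x \in D) -> #|D| = 1.
Proof.
case=> x [xD ux]; apply/eqP/cards1P; exists x; apply/setP=> y.
by rewrite inE; apply/idP/eqP => [/ux -> // | ->].
Qed.

Lemma extend_to_card (T : finType) (S : {set T}) (j : nat) :
  #|S| <= j <= #|T| -> exists2 S' : {set T}, S \subset S' & #|S'| = j.
Proof.
elim: j => [|j IHj] /andP[leSj lejT].
  by exists S => //; lia.
have [eqSj|neSj] := eqVneq #|S| j.+1; first by exists S.
have [|S' sSS' cS'] := IHj; first by apply/andP; split; lia.
have /card_gt0P[x] : 0 < #|~: S'| by have := cardsC S'; lia.
rewrite inE => xS'; exists (x |: S').
  by apply: subset_trans sSS' (subsetUr _ _).
by rewrite cardsU1 xS' cS'.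
Qed.

Lemma sum_squares_le (T : finType) (P : pred T) (e : T -> nat) :
  \sum_(i | P i) e i * e i <= (\sum_(i | P i) e i) * (\sum_(i | P i) e i).
Proof.
rewrite [leqRHS]big_distrl /=; apply: leq_sum => i Pi.
by rewrite leq_mul2l (bigD1 i) //= leq_addr orbT.
Qed.

Lemma cauchy_schwarz_card (T : finType) (S : {set T}) (r : T -> nat) :
  (\sum_(x in S) r x) * (\sum_(x in S) r x) <= #|S| * \sum_(x in S) r x * r x.
Proof.
rewrite -(leq_pmul2l (isT : 0 < 2)).
have -> : 2 * (#|S| * \sum_(x in S) r x * r x) =
    \sum_(x in S) \sum_(y in S) (r x * r x + r y * r y).
  under [RHS]eq_bigr => x _ do rewrite big_split /= sum_nat_const.
  by rewrite big_split /= sum_nat_const -big_distrr /=; lia.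
rewrite big_distrlr /= big_distrr /=; apply: leq_sum => x _.
rewrite big_distrr /=; apply: leq_sum => y _.
by rewrite !mulnn; apply: (nat_Cauchy (r x) (r y)).1.
Qed.

Lemma exchange_incidence (T : finType) (L : {set {set T}}) (S : {set T})
    (f : {set T} -> T -> nat) :
  \sum_(l in L) \sum_(y in l :&: S) f l y =
  \sum_(y in S) \sum_(l in [set l in L | y \in l]) f l y.
Proof.
rewrite (exchange_big_dep (fun y => y \in S)) /=; last first.
  by move=> l y _; rewrite inE => /andP[].
apply: eq_bigr => y yS; apply: eq_bigl => l.
by rewrite !inE yS andbT.
Qed.

Lemma sum_incidence (T : finType) (L : {set {set T}}) (S : {set T}) :
  \sum_(l in L) #|l :&: S| = \sum_(y in S) #|[set l in L | y \in l]|.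
Proof.
under eq_bigr => l _ do rewrite -sum1_card.
by rewrite exchange_incidence; apply: eq_bigr => y _; rewrite sum1_card.
Qed.

(** Write r(x) for the number of members of L through x, and t for the sum of r
    over S. By Cauchy-Schwarz, t^2 is at most |S| times the sum of r(x)^2 over
    S. That sum counts triples (l, m, x) with x in l, m and S: each pair l = m
    contributes |l & S|, and each pair of distinct sets at most 1. *)
Lemma linear_family_bound (T : finType) (L : {set {set T}}) (S : {set T}) :
  {in L &, forall l m, l != m -> #|l :&: m| <= 1} ->
  let t := \sum_(l in L) #|l :&: S| in
  t * t + #|S| * #|L| <= #|S| * (t + #|L| * #|L|).
Proof.
move=> meetL /=; set t := \sum_(l in L) _.
pose r x := #|[set l in L | x \in l]|.
have tE : t = \sum_(x in S) r x by apply: sum_incidence.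
suff : (\sum_(x in S) r x * r x) + #|L| <= t + #|L| * #|L|.
  move=> le_sq; apply: leq_trans (leq_mul (leqnn #|S|) le_sq).
  by rewrite mulnDr leq_add2r tE cauchy_schwarz_card.
have -> : \sum_(x in S) r x * r x =
    \sum_(l in L) \sum_(m in L) #|m :&: (l :&: S)|.
  under [RHS]eq_bigr => l _ do rewrite sum_incidence.
  rewrite exchange_incidence; apply: eq_bigr => x _.
  by rewrite sum_nat_const.
rewrite -[in X in _ + X <= _]sum1_card -sum_nat_const -!big_split /=.
apply: leq_sum => l lL; rewrite (bigD1 l) //= setIA setIid.
rewrite -addnA leq_add2l (cardD1 l L) lL /= addnC leq_add2l.
have -> : #|[predD1 L & l]| = \sum_(m in L | m != l) 1.
  by rewrite -sum1_card; apply: eq_bigl => m; rewrite !inE andbC.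
apply: leq_sum => m /andP[mL ml].
apply: leq_trans (meetL m l mL lL ml); apply: subset_leq_card.
by apply: setIS; apply: subsetIl.
Qed.

(** The three extreme shapes of a family with sum n + 2 are {n + 1, 1}, {n, 2}
    and {n - 1, 3}. The third gives n^2 - 2n + 10, and the bonuses 4n - 8 and
    2n - 6 are what the first two have in addition. *)
Lemma sum_squares_bound (T : finType) (D : {set T}) (e : T -> nat) (n : nat) :
  5 <= n -> \sum_(i in D) e i = n + 2 -> {in D, forall i, e i <= n.+1} ->
  \sum_(i in D) e i * e i + 2 * n <= n * n + 10 +
    \sum_(i in D) ((e i == n.+1) * (4 * n - 8) + (e i == n) * (2 * n - 6)).
Proof.
move=> n5 sum_e max_e.
have [i /andP[iD ei3]|small] := pickP [pred i | (i \in D) && (3 <= e i)].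
  (* All other terms sum to n + 2 - e i, so their squares to at most
     (n + 2 - e i)^2; for 3 <= e i <= n - 1 convexity puts the extreme at the
     ends of the range, where both give the third shape. *)
  have := max_e i iD; move: sum_e.
  rewrite !(bigD1 i iD) /=.
  have := sum_squares_le (fun j => (j \in D) && (j != i)) e.
  set rest := \sum_(j | _) e j; set rest2 := \sum_(j | _) e j * e j.
  set g := \sum_(j | _) (_ + _) => le_rest sum_e le_e.
  have [e1|ne1] := eqVneq (e i) n.+1; first by nia.
  have [e0|ne0] := eqVneq (e i) n; first by nia.
  by have : 0 <= g by []; nia.
have : \sum_(i in D) e i * e i <= \sum_(i in D) 2 * e i.
  apply: leq_sum => i iD; move: (small i); rewrite /= iD /= => ei.
  by rewrite leq_mul2r; lia.
by rewrite -big_distrr /= sum_e; nia.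
Qed.

(** * The two estimates are incompatible *)

Section Arithmetic.
Local Open Scope Z_scope.

(* Proves 0 <= p when all coefficients of the polynomial p are nonnegative and
   its variables are. Only the normal form is taken from ring_simplify: the
   equality is proved again by ring, whose certificate the kernel checks much
   faster. *)
Ltac nonneg_coefficients :=
  match goal with |- 0 <= ?p =>
    let w := constr:(ltac:(eexists; ring_simplify; reflexivity)
                     : exists p', p = p') in
    match w with context [ex_intro _ ?p' _] =>
      replace p with p' by ring
    end
  end;
  repeat lazymatch goal with
  | |- 0 <= _ + _ => apply: Z.add_nonneg_nonneg
  | |- 0 <= _ * _ => apply: Z.mul_nonneg_nonneg
  | |- 0 <= _ ^ _ => apply: Z.pow_nonneg
  | |- _ => lia
  end.

(** With q = n^2 + d, these are the coefficients of the quadratic form in a and b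
    that counting_contradiction compares with 0. For d >= 5 the substitution
    d = 5 + i, n = 5 + i + j, and for each smaller d the substitution n = 5 + i,
    turns every expression into a polynomial without negative coefficients. *)
Lemma form_coefficients (n d : Z) : 5 <= n -> 0 <= d <= n ->
  let R := (n * n + d + 1) * (3 * n - 9 + d) + n - 1 - d in
  let K := n * n + n + 2 + d in
  let Caa := (3 * n + 2 - d) * R - K * (n + 1) * (4 * n - 8) in
  let Cab := 2 * (2 * n - d) * R
    - K * ((n + 1) * (2 * n - 6) + n * (4 * n - 8)) in
  let Cbb := (n - 1 - d) * R - K * n * (2 * n - 6) in
  [/\ 0 <= Caa - 1, 0 <= Cab & 0 <= (n - 4 + d) * Cab + (n + 1 - d) * Cbb].
Proof.
move=> n5 [d0 dn]; cbv zeta.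
have [d5|d5] : 5 <= d \/ d < 5 by lia.
  have [i [j [i0 [j0 [-> ->]]]]] : exists i j,
      0 <= i /\ 0 <= j /\ d = 5 + i /\ n = 5 + i + j.
    by exists (d - 5), (n - d); lia.
  by split; nonneg_coefficients.
have [i [i0 ->]] : exists i, 0 <= i /\ n = 5 + i by exists (n - 5); lia.
have [->|[->|[->|[->|->]]]] : d = 0 \/ d = 1 \/ d = 2 \/ d = 3 \/ d = 4 by lia.
all: by split; nonneg_coefficients.
Qed.

(** The coefficient of a^2 for d = n + 1. The one of ab can be negative there,
    but b vanishes. *)
Lemma form_coefficient_top (n : Z) : 5 <= n ->
  0 <= (2 * n + 1) * ((n * n + n + 2) * (4 * n - 8) - 2)
    - (n * n + 2 * n + 3) * (n + 1) * (4 * n - 8) - 1.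
Proof.
move=> n5.
have [i [i0 ->]] : exists i, 0 <= i /\ n = 5 + i by exists (n - 5); lia.
nonneg_coefficients.
Qed.

(** The hypothesis says that the long lines supply the squares required on
    average by the q + 1 = n^2 + d + 1 parallel classes. Since a + b <= q + 1,
    subtracting (a + b)(3n - 9 + d) from both sides bounds b in terms of a. *)
Lemma long_line_counts (n d a b : Z) :
  5 <= n -> 0 <= d -> 0 <= a -> 0 <= b -> a + b <= n * n + d + 1 ->
  (n * n + d + 1) * (3 * n - 9 + d) + n - 1 - d
    <= a * (4 * n - 8) + b * (2 * n - 6) ->
  [/\ b * (n - 3 + d) + (n - 1 - d) <= a * (n + 1 - d), d <= n + 1 & 1 <= a].
Proof.
move=> n5 d0 a0 b0 ab.
have w1 : 0 <= 3 * n - 9 + d by lia.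
have w2 : 0 <= 4 * n - 8 by lia.
have w3 : 0 <= 2 * n - 2 by lia.
have w4 : 0 <= n - 3 + d by lia.
have M26 : 25 <= n * n by have := Z.mul_le_mono_nonneg 5 n 5 n; lia.
move: ab; set M := n * n + d + 1 => ab.
have {}M26 : 26 <= M by rewrite /M; lia.
have ab' : 0 <= M - (a + b) by lia.
have p1 := Z.mul_nonneg_nonneg _ _ ab' w1.
have p2 := Z.mul_nonneg_nonneg _ _ ab' w2.
have p3 := Z.mul_nonneg_nonneg _ _ b0 w3.
have p4 := Z.mul_nonneg_nonneg _ _ b0 w4.
move: M ab ab' M26 p1 p2 p3 => M ab ab' M26 p1 p2 p3 RL.
have C1 : b * (n - 3 + d) + (n - 1 - d) <= a * (n + 1 - d) by lia.
have dn : d <= n + 1.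
  have big : M * (d - n - 1) <= d - n - 1 + 2 by lia.
  have [//|dn] : d <= n + 1 \/ 1 <= d - n - 1 by lia.
  have := Z.mul_le_mono_nonneg 4 M 1 (d - n - 1).
  have := Z.mul_le_mono_nonneg_r 4 M (d - n - 1).
  clear - big dn M26; lia.
split=> //.
have [a00|//] : a = 0 \/ 1 <= a by lia.
move: C1 RL; rewrite a00 => C1 RL.
have [b00|b1] : b = 0 \/ 1 <= b by lia.
  have w5 : 0 <= M - 1 by lia.
  have := Z.mul_nonneg_nonneg _ _ w5 w1.
  by move: RL; rewrite b00; clear - w1 n5 d0; lia.
have := Z.mul_le_mono_nonneg_r 1 b (n - 3 + d).
clear - C1 w4 b1 n5 d0; lia.
Qed.

(** Cbb may be negative, but then b^2 is controlled by ab through the ratio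
    b <= a v / u. *)
Lemma form_positive (a b u v Caa Cab Cbb : Z) :
  1 <= a -> 0 <= b -> 1 <= u -> b = 0 \/ b * u <= a * v ->
  0 <= Caa - 1 -> 0 <= Cab -> 0 <= u * Cab + v * Cbb ->
  0 < a * a * Caa + a * b * Cab + b * b * Cbb.
Proof.
move=> a1 b0 u1 ratio Caa1 Cab0 mixed.
have a0 : 0 <= a by lia.
have aa1 : 1 <= a * a by have := Z.mul_le_mono_nonneg 1 a 1 a; lia.
have aa0 : 0 <= a * a by lia.
have ab0 : 0 <= a * b by exact: Z.mul_nonneg_nonneg.
have aaC : 1 <= a * a * Caa.
  by have := Z.mul_nonneg_nonneg _ _ aa0 Caa1; lia.
have abC := Z.mul_nonneg_nonneg _ _ ab0 Cab0.
have bb0 : 0 <= b * b by exact: Z.mul_nonneg_nonneg.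
have [Cbb0|Cbb0] : 0 <= Cbb \/ 0 <= - Cbb by lia.
  by have := Z.mul_nonneg_nonneg _ _ bb0 Cbb0; lia.
have {}ratio : b * (b * u) <= b * (a * v).
  by case: ratio => [->|ratio]; [lia|apply: Z.mul_le_mono_nonneg_l].
have C2 : 0 <= a * b * v - b * b * u by clear - ratio; lia.
have p1 := Z.mul_nonneg_nonneg _ _ C2 Cbb0.
have p2 := Z.mul_nonneg_nonneg _ _ ab0 mixed.
have p3 : u <= u * (a * a * Caa).
  have aaC0 : 0 <= a * a * Caa - 1 by lia.
  have u0 : 0 <= u by lia.
  have := Z.mul_nonneg_nonneg _ _ u0 aaC0; clear; lia.
suff : 0 < u * (a * a * Caa + a * b * Cab + b * b * Cbb).
  by move/(Z.mul_pos_cancel_l u); apply; clear - u1; lia.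
clear - p1 p2 p3 u1; lia.
Qed.

(** In the notation of the proof, the first estimate reads R <= L and the second
    Q <= K(a(n + 1) + bn), with R and K free of a and b, L linear and Q quadratic
    in them. Multiplying the second by R and then replacing R by L on the right
    makes both sides quadratic forms in (a, b), and the difference of the two
    forms is positive. *)
Lemma counting_contradiction (n q a b : Z) :
  5 <= n -> n * n <= q -> 0 <= a -> 0 <= b -> a + b <= q + 1 ->
  let s := q + n + 2 in
  let t := a * (n + 2) + b * (n + 1) in
  s * (s + q) <= 2 * ((q + 1) * (n + 2)) + (q + 1) * q
    + (q + 1) * (n * n - 2 * n + 10) + a * (4 * n - 8) + b * (2 * n - 6) ->
  t * t + s * (a + b) <= s * (t + (a + b) * (a + b)) -> False.
Proof.
move=> n5; cbv zeta.
have [d ->] : exists d, q = n * n + d by exists (q - n * n); lia.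
move=> d_ge0 a0 b0 ab squares second.
have {}d_ge0 : 0 <= d by clear - d_ge0; lia.
pose R := (n * n + d + 1) * (3 * n - 9 + d) + n - 1 - d.
pose K := n * n + n + 2 + d.
pose L := a * (4 * n - 8) + b * (2 * n - 6).
pose Q := a * a * (3 * n + 2 - d) + 2 * (a * b) * (2 * n - d)
  + b * b * (n - 1 - d).
have RL : R <= L by rewrite /R /L; clear - squares; lia.
have QK : Q <= K * (a * (n + 1) + b * n).
  by rewrite /Q /K; clear - second; lia.
clear squares second.
have [C1 dn1 a1] := long_line_counts n5 d_ge0 a0 b0 ab RL.
have form : Q * R <= K * (a * (n + 1) + b * n) * L.
  have R0 : 0 <= R.
    have M0 : 0 <= n * n + d + 1 by clear - n5 d_ge0; lia.
    have w1 : 1 <= 3 * n - 9 + d by clear - n5 d_ge0; lia.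
    have w2 : n + d <= n * n + d + 1 by clear - n5 d_ge0; nia.
    have := Z.mul_le_mono_nonneg_l _ _ _ M0 w1.
    rewrite /R; clear - n5 d_ge0 w2; lia.
  have nn0 : 0 <= n * n by apply: Z.square_nonneg.
  have K0 : 0 <= K by rewrite /K; clear - n5 d_ge0 nn0; lia.
  have an0 : 0 <= a * (n + 1).
    by apply: Z.mul_nonneg_nonneg => //; clear - n5; lia.
  have bn0 : 0 <= b * n.
    by apply: Z.mul_nonneg_nonneg => //; clear - n5; lia.
  apply: (Z.le_trans _ (K * (a * (n + 1) + b * n) * R)).
    by apply: Z.mul_le_mono_nonneg_r.
  apply: Z.mul_le_mono_nonneg_l => //; apply: Z.mul_nonneg_nonneg => //.
  exact: Z.add_nonneg_nonneg.
have [dn|dn] : d = n + 1 \/ d <= n by clear - dn1; lia.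
  (* The average nearly forces a line of excess n + 1 into every parallel
     class, so no class has room for a line of excess n. *)
  have b00 : b = 0.
    have := Z.mul_nonneg_nonneg b (2 * n - 8).
    by move: C1; rewrite dn; clear - n5 b0; lia.
  have top := form_coefficient_top n5.
  have aa0 : 1 <= a * a.
    by have := Z.mul_le_mono_nonneg 1 a 1 a; clear - a1; lia.
  have aa0' : 0 <= a * a by clear - aa0; lia.
  have := Z.mul_nonneg_nonneg _ _ aa0' top.
  by move: form; rewrite /Q /R /K /L dn b00; clear - aa0; lia.
have [Caa1 Cab0 mixed] := form_coefficients n5 (conj d_ge0 dn).
have u1 : 1 <= n - 4 + d by clear - n5 d_ge0; lia.
(* If b >= 1, weakening n - 3 + d to n - 4 + d absorbs the constant
   n - 1 - d >= -1. *)
have ratio : b = 0 \/ b * (n - 4 + d) <= a * (n + 1 - d).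
  by clear - C1 dn b0; lia.
have := form_positive a1 b0 u1 ratio Caa1 Cab0 mixed.
by move: form; rewrite /Q /R /K /L; clear; lia.
Qed.

End Arithmetic.

(** * Counting in an affine plane of order q *)

Section AffinePlane.

Variables (A : affine_plane) (q : nat).
Hypothesis A_order : has_order A q.
Implicit Types (x y : point A) (l m S : {set point A}).

Definition pencil x := [set l in lines A | x \in l].

Definition parallel_class l :=
  [set m in lines A | (m == l) || [disjoint m & l]].

Lemma line_unique x y l m : x != y -> l \in lines A -> m \in lines A ->
  x \in l -> y \in l -> x \in m -> y \in m -> l = m.
Proof.
move=> xy lA mA xl yl xm ym; have [k [_ uk]] := line_through xy.
by rewrite -(uk l) // -(uk m).
Qed.

Lemma card_meet l m : l \in lines A -> m \in lines A -> l != m ->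
  #|l :&: m| <= 1.
Proof.
move=> lA mA; rewrite leqNgt; apply: contraNN => /card_gt1P[x [y [xI yI xy]]].
move: xI yI; rewrite !inE => /andP[xl xm] /andP[yl ym].
by apply/eqP; apply: line_unique xy _ _ _ _ _ _.
Qed.

(** The only point on the sides uv and uw of a triangle is u, which is not on the
    side vw. *)
Lemma line_avoiding x : exists2 l, l \in lines A & x \notin l.
Proof.
have [u [v [w [uv vw uw noncol]]]] := noncollinear A.
have [a [[aA ua va] _]] := line_through uv.
have [b [[bA vb wb] _]] := line_through vw.
have [c [[cA uc wc] _]] := line_through uw.
have [xa|] := boolP (x \in a); last by exists a.
have [xb|] := boolP (x \in b); last by exists b.
have [xc|] := boolP (x \in c); last by exists c.
have xu : x = u.
  apply/eqP/negPn/negP => xu.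
  have ac : a = c by apply: line_unique xu _ _ _ _ _ _.
  by case: (noncol a aA); split=> //; rewrite ac.
by case: (noncol b bA); split=> //; rewrite -xu.
Qed.

Lemma card_common_lines x y : x != y ->
  #|[set l in pencil x | y \in l]| = 1.
Proof.
move=> xy; have [l [[lA xl yl] ul]] := line_through xy.
apply: card_unique; exists l; split; first by rewrite !inE lA xl yl.
by move=> m; rewrite !inE => /andP[/andP[mA xm] ym]; apply: ul.
Qed.

(** Every point of S other than x lies on exactly one line through x, and x lies
    on all of them. *)
Lemma sum_pencil x S :
  \sum_(l in pencil x) #|l :&: S| = #|S :\ x| + (x \in S) * #|pencil x|.
Proof.
rewrite sum_incidence.
have off y : y != x -> #|[set l in pencil x | y \in l]| = 1.
  by rewrite eq_sym; apply: card_common_lines.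
rewrite -sum1_card; under [X in _ = X + _]eq_bigl => y do rewrite !inE andbC.
have [xS|xS] := boolP (x \in S).
  rewrite (bigD1 x) //= mul1n addnC; congr (_ + _); last first.
    apply: eq_card => l; rewrite !inE.
    by case: (x \in l); rewrite ?andbF ?andbT.
  by apply: eq_bigr => y /andP[_ /off].
rewrite mul0n addn0.
rewrite [RHS](eq_bigl (mem S)); last first.
  by move=> y /=; case yS: (y \in S) => //=; apply: contraNneq xS => <-.
apply: eq_bigr => y yS; apply: off; apply: contraNneq xS => <- //.
Qed.

Lemma card_parallel_through x l : l \in lines A ->
  #|[set m in parallel_class l | x \in m]| = 1.
Proof.
move=> lA; apply: card_unique.
have [xl|xl] := boolP (x \in l).
  exists l; split; first by rewrite !inE lA eqxx xl.
  move=> m; rewrite !inE => /andP[/andP[mA /orP[/eqP-> //|dml]] xm].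
  by have := disjointFr dml xm; rewrite xl.
have [m [[mA xm dml] um]] := parallel_through lA xl.
exists m; split; first by rewrite !inE mA xm dml orbT.
move=> k; rewrite !inE => /andP[/andP[kA /orP[/eqP kl|dkl]] xk].
  by move: xl; rewrite -kl xk.
by apply: um.
Qed.

Lemma sum_class l S : l \in lines A ->
  \sum_(m in parallel_class l) #|m :&: S| = #|S|.
Proof.
move=> lA; rewrite sum_incidence -sum1_card.
by apply: eq_bigr => y _; apply: card_parallel_through.
Qed.

(** Take a line l not through x. All lines through x meet l in one point, except
    the parallel to l, and they cover the q points of l. *)
Lemma card_pencil x : #|pencil x| = q + 1.
Proof.
have [l lA xl] := line_avoiding x.
have := sum_pencil x l; rewrite (negbTE xl) mul0n addn0.
have -> : l :\ x = l.
  by apply/setP=> y; rewrite !inE; case: eqP => // ->; rewrite (negbTE xl).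
rewrite (A_order lA) => <-.
rewrite -(card_parallel_through x lA).
have -> : [set m in parallel_class l | x \in m] =
          [set m in pencil x | [disjoint m & l]].
  apply/setP=> m; rewrite !inE; case xm: (x \in m); rewrite ?andbF //= !andbT.
  by have [ml|//] := eqVneq m l; rewrite -ml xm in xl.
rewrite -sum_indicator -big_split -sum1_card /=.
apply: eq_bigr => m; rewrite inE => /andP[mA xm].
have ml : m != l by apply: contraNneq xl => <-.
have := card_meet mA lA ml; rewrite -setI_eq0 -cards_eq0.
by case: #|_| => [|[]].
Qed.

(** The q + 1 lines through x carry q - 1 further points each. *)
Lemma card_points : #|point A| = q * q.
Proof.
have [x _] := noncollinear A; have := sum_pencil x setT.
rewrite in_setT mul1n card_pencil (eq_bigr (fun=> q)).
  rewrite sum_nat_const card_pencil.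
  have := cardsD1 x [set: point A]; rewrite in_setT cardsT; lia.
by move=> l; rewrite inE setIT => /andP[/A_order].
Qed.

Lemma card_class l : 0 < q -> l \in lines A -> #|parallel_class l| = q.
Proof.
move=> q0 lA; apply/eqP; rewrite -(eqn_pmul2r q0) -card_points -cardsT.
rewrite -(sum_class setT lA) (eq_bigr (fun=> q)) ?sum_nat_const //.
by move=> m; rewrite inE setIT => /andP[/A_order].
Qed.

(** The lines through x represent the parallel classes: each line has exactly one
    parallel through x, itself if it contains x. *)
Lemma sum_lines_by_class x (f : {set point A} -> nat) :
  \sum_(m in lines A) f m =
  \sum_(l in pencil x) \sum_(m in parallel_class l) f m.
Proof.
rewrite (exchange_big_dep (fun m => m \in lines A)) /=; last first.
  by move=> l m _; rewrite inE => /andP[].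
apply: eq_bigr => m mA.
rewrite sum_nat_const.
rewrite -[LHS]mul1n -(card_parallel_through x mA); congr (_ * _).
apply: eq_card => l; rewrite !inE [RHS]unfold_in /= !inE mA /=.
by rewrite (eq_sym m) (disjoint_sym m) andbAC.
Qed.

End AffinePlane.

(** * Blocking sets of size q + n + 2 *)

Section BlockingSet.

Variables (A : affine_plane) (q n : nat) (B : {set point A}).
Hypothesis A_order : has_order A q.
Hypothesis B_blocking : blocking_set B.
Hypothesis n_ge5 : 5 <= n.
Hypothesis nn_le_q : n * n <= q.
Hypothesis card_B : #|B| = q + n + 2.
Implicit Types (x : point A) (l m : {set point A}).

(** Each line already needs one point in order to be blocked. *)
Definition excess l := #|l :&: B|.-1.

Lemma card_secant l : l \in lines A -> #|l :&: B| = (excess l).+1.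
Proof.
move=> lA; rewrite /excess prednK //; apply/card_gt0P.
by have [x xl xB] := B_blocking lA; exists x; rewrite inE xl.
Qed.

Lemma sum_excess_class l : l \in lines A ->
  \sum_(m in parallel_class l) excess m = n + 2.
Proof.
move=> lA; have := sum_class B lA.
rewrite (eq_bigr (fun m => excess m + 1)); last first.
  by move=> m; rewrite inE addn1 => /andP[/card_secant].
rewrite big_split sum1_card /= (card_class A_order _ lA); [lia|nia].
Qed.

Lemma sum_excess_pencil x : x \notin B ->
  \sum_(m in pencil x) excess m = n.+1.
Proof.
move=> xB; have := sum_pencil x B.
rewrite (negbTE xB) mul0n addn0.
have -> : B :\ x = B.
  by apply/setP=> y; rewrite !inE; case: eqP => // ->; rewrite (negbTE xB).
rewrite (eq_bigr (fun m => excess m + 1)); last first.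
  by move=> m; rewrite inE addn1 => /andP[/card_secant].
rewrite big_split sum1_card /= (card_pencil A_order); lia.
Qed.

(** A line inside B would have excess q - 1, more than its whole parallel class.
    Otherwise some point x of l is outside B, and the excesses of the lines
    through x sum to n + 1. *)
Lemma excess_le l : l \in lines A -> excess l <= n.+1.
Proof.
move=> lA; have [lB|/subsetPn[x xl xB]] := boolP (l \subset B).
  have := sum_excess_class lA; rewrite (bigD1 l) /=; last first.
    by rewrite inE lA eqxx.
  rewrite {1}/excess (setIidPl lB) (A_order lA); nia.
rewrite -(sum_excess_pencil xB) (bigD1 l) ?leq_addr //.
by rewrite inE lA.
Qed.

Lemma long_lines_second_moment (a b : nat) :
  a = \sum_(l in lines A) (excess l == n.+1) ->
  b = \sum_(l in lines A) (excess l == n) ->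
  let t := a * (n + 2) + b * (n + 1) in
  t * t + #|B| * (a + b) <= #|B| * (t + (a + b) * (a + b)).
Proof.
move=> aE bE; pose F := [set l in lines A | n <= excess l].
have cF : #|F| = a + b.
  rewrite -sum_indicator aE bE -big_split; apply: eq_bigr => l lA /=.
  by have := excess_le lA; lia.
have tF : \sum_(l in F) #|l :&: B| = a * (n + 2) + b * (n + 1).
  rewrite aE bE !big_distrl -big_split /=.
  rewrite (eq_bigl (fun l => (l \in lines A) && (n <= excess l))); last first.
    by move=> l; rewrite inE.
  rewrite big_mkcondr; apply: eq_bigr => l lA /=.
  rewrite (card_secant lA); have le_e := excess_le lA.
  by case: leqP => ?; do 2![case: eqP => ?]; rewrite ?mul1n ?mul0n; lia.
rewrite /= -tF -cF; apply: linear_family_bound => l m.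
by rewrite !inE => /andP[lA _] /andP[mA _]; apply: card_meet.
Qed.

(** A parallel class has total excess n + 2 < 2n, hence at most one long line. *)
Lemma long_lines_le :
  \sum_(l in lines A) (excess l == n.+1) + \sum_(l in lines A) (excess l == n)
    <= q + 1.
Proof.
have [x _] := noncollinear A.
rewrite -big_split (sum_lines_by_class x) /=.
rewrite -(card_pencil A_order x) -sum1_card.
apply: leq_sum => l; rewrite inE => /andP[lA _].
have := sum_excess_class lA; set c := (X in _ -> X <= _).
have : c * n <= \sum_(m in parallel_class l) excess m.
  by rewrite big_distrl; apply: leq_sum => m _ /=; lia.
nia.
Qed.

Lemma sum_secant_squares :
  \sum_(l in lines A) #|l :&: B| * #|l :&: B| = #|B| * (#|B| + q).
Proof.
under eq_bigr => l _ do rewrite -sum_nat_const.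
rewrite exchange_incidence -sum_nat_const; apply: eq_bigr => x xB.
have -> : [set l in lines A | x \in l] = pencil x by [].
rewrite sum_pencil xB (card_pencil A_order).
by have := cardsD1 x B; rewrite xB; lia.
Qed.

(** From #|l :&: B|^2 = (e(l) + 1)^2, summed over all lines. *)
Lemma excess_squares_bound :
  #|B| * (#|B| + q) <= 2 * ((q + 1) * (n + 2)) + (q + 1) * q
    + \sum_(l in lines A) excess l * excess l.
Proof.
have [x _] := noncollinear A; rewrite -sum_secant_squares.
have linesE : #|lines A| = (q + 1) * q.
  rewrite -sum1_card (sum_lines_by_class x) -(card_pencil A_order x).
  rewrite -sum_nat_const; apply: eq_bigr => l; rewrite inE => /andP[lA _].
  by rewrite sum1_card (card_class A_order) //; nia.
have excessE : \sum_(l in lines A) excess l = (q + 1) * (n + 2).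
  rewrite (sum_lines_by_class x) -(card_pencil A_order x).
  rewrite -sum_nat_const; apply: eq_bigr => l; rewrite inE => /andP[lA _].
  exact: sum_excess_class.
rewrite -linesE -excessE big_distrr -sum1_card -!big_split /=.
by apply: leq_sum => l lA; rewrite (card_secant lA); lia.
Qed.

Lemma sum_excess_squares_le :
  \sum_(l in lines A) excess l * excess l + (q + 1) * (2 * n) <=
  (q + 1) * (n * n + 10)
    + (\sum_(l in lines A) (excess l == n.+1)) * (4 * n - 8)
    + (\sum_(l in lines A) (excess l == n)) * (2 * n - 6).
Proof.
have [x _] := noncollinear A.
rewrite !big_distrl -addnA -big_split !(sum_lines_by_class x).
rewrite -(card_pencil A_order x) -!sum_nat_const -!big_split /=.
apply: leq_sum => l; rewrite inE => /andP[lA _].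
apply: sum_squares_bound => //; first exact: sum_excess_class.
by move=> m; rewrite inE => /andP[/excess_le].
Qed.

Lemma no_blocking_set : False.
Proof.
have second := long_lines_second_moment erefl erefl.
have := sum_excess_squares_le; have := excess_squares_bound.
have := long_lines_le; move: second.
rewrite card_B /=; set e2 := \sum_(l in _) _ * _.
set a := \sum_(l in _) (_ == _.+1); set b := \sum_(l in _) (_ == n).
move=> second ab sq1 sq2.
apply: (@counting_contradiction (Z.of_nat n) (Z.of_nat q) (Z.of_nat a)
  (Z.of_nat b)); cbv zeta; lia.
Qed.

End BlockingSet.

(* PeanoNat.Nat.sqrt is the floor of the square root. *)
Theorem mainTheorem1 (A : affine_plane) (q : nat) (hA : has_order A q)
  (hq : 25 <= q) (B : {set point A}) (hB : blocking_set B) :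
  q + PeanoNat.Nat.sqrt q + 3 <= #|B|.
Proof.
have [] := PeanoNat.Nat.sqrt_spec q (PeanoNat.Nat.le_0_l q).
set n := PeanoNat.Nat.sqrt q => nn_le nn_gt.
rewrite leqNgt; apply/negP => small.
have n5 : 5 <= n by nia.
have [|B' sBB' cB'] := @extend_to_card _ B (q + n + 2).
  by rewrite (card_points hA); nia.
apply: (@no_blocking_set A q n B') => //; last by nia.
by move=> l /hB[x xl xB]; exists x => //; apply: (subsetP sBB').
Qed.
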